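(* For all integers $n,\ell\ge1$, $$(-1)^{\ell-1}\sum_{j=-\ell+1}^{\ell}(-1)^j\,\overline{p}(n-j^2)\ge0,$$ with strict inequality if $n\ge\ell^2$.
   Context: $\overline{p}(n)$ denotes the number of overpartitions of $n$, i.e. partitions of $n$ in which the first occurrence of each part size may be overlined or not, with $\overline{p}(0)=1$ and $\overline{p}(n)=0$ for $n<0$; its generating function is $\sum_{n\ge0}\overline{p}(n)q^n=\prod_{m\ge1}\frac{1+q^m}{1-q^m}$. *)

(* Defs.v *)
From mathcomp Require Import all_boot all_order all_algebra.

Set Implicit Arguments.
Unset Strict Implicit.
Unset Printing Implicit Defensive.

Import Order.TTheory GRing.Theory Num.Theory.

(* A part is a pair (size, overlined?).  In a non-increasing list, a part is
   the first occurrence of its size iff it is strictly smaller than the part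
   just before it; only such a part may be overlined. *)
Definition may_follow (x y : nat * bool) : bool :=
  (y.1 < x.1) || (y.1 == x.1) && ~~ y.2.

Definition is_overpartition (n : nat) (s : seq (nat * bool)) : bool :=
  [&& sorted may_follow s, all (fun x => 0 < x.1) s
    & sumn [seq x.1 | x <- s] == n].

Definition forget_bound (n : nat) (x : 'I_n.+1 * bool) : nat * bool :=
  (val x.1, x.2).

(* An overpartition of n has at most n parts, each at most n, so these bounds,
   present only to have a finite type to count in, lose nothing: see
   [num_overpartitionsE]. *)
Definition num_overpartitions (n : nat) : nat :=
  #|[set s : n.-bseq ('I_n.+1 * bool)
      | is_overpartition n [seq forget_bound x | x <- s]]|.

Lemma overpartition_bounds (n : nat) (s : seq (nat * bool)) :
  is_overpartition n s -> size s <= n /\ all (fun x => x.1 <= n) s.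
Proof.
case/and3P=> _ pos /eqP <-; elim: s pos => //= x s IHs /andP[x0 /IHs[sz le]].
split; first by rewrite -add1n leq_add.
rewrite leq_addr; apply/allP=> y ys.
by apply: leq_trans (allP le _ ys) (leq_addl _ _).
Qed.

Lemma num_overpartitionsE (n : nat) (e : seq (seq (nat * bool))) :
  uniq e -> (forall s, (s \in e) = is_overpartition n s) ->
  num_overpartitions n = size e.
Proof.
move=> ue eP; rewrite /num_overpartitions cardE.
pose f (s : n.-bseq ('I_n.+1 * bool)) := [seq forget_bound x | x <- s].
have fI : injective f.
  move=> s t /inj_map est; apply/val_inj/est.
  by case=> [i b] [j c] [/val_inj -> ->].
rewrite -(size_map f); apply/perm_size/uniq_perm => //.
  by rewrite map_inj_uniq ?enum_uniq.
move=> s; rewrite eP; apply/mapP/idP => [[t]|sP].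
  by rewrite mem_enum inE => tP ->.
have [sz /allP le] := overpartition_bounds sP.
pose g (x : nat * bool) : 'I_n.+1 * bool := (inord x.1, x.2).
have sgz : size (map g s) <= n by rewrite size_map.
have fg : s = f (Bseq sgz).
  rewrite /f /= -map_comp -[LHS]map_id; apply/eq_in_map => -[a b] /le /= an.
  by rewrite /forget_bound /= inordK.
by exists (Bseq sgz); rewrite // mem_enum inE -/(f _) -fg.
Qed.


(* The convention that there are no overpartitions of a negative integer. *)
Definition pbar (z : int) : int :=
  if z is Posz n then Posz (num_overpartitions n) else 0%R.

(* The integers a, a + 1, ..., b in order (none if b < a). *)
Definition int_range (a b : int) : seq int :=
  if (a <= b)%R then [seq (a + k%:Z)%R | k <- iota 0 `|b - a|.+1] else [::].

Lemma mem_int_range (a b j : int) : (j \in int_range a b) = (a <= j <= b)%R.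
Proof.
rewrite /int_range; case: ifP => ab; last first.
  by apply/esym/negP => /andP[aj jb]; rewrite (le_trans aj jb) in ab.
have ba : Posz `|b - a|%N = (b - a)%R by rewrite gez0_abs ?subr_ge0.
apply/mapP/andP => [[k]|[aj jb]].
  rewrite mem_iota add0n ltnS /= -lez_nat ba => kb ->.
  by rewrite lerDl -lerBrDl.
have ja : Posz `|j - a|%N = (j - a)%R by rewrite gez0_abs ?subr_ge0.
exists `|j - a|; last by rewrite ja addrC subrK.
by rewrite mem_iota add0n ltnS /= -lez_nat ja ba lerD2r.
Qed.

Lemma int_range_uniq (a b : int) : uniq (int_range a b).
Proof.
rewrite /int_range; case: ifP => // _.
by rewrite map_inj_uniq ?iota_uniq // => x y /addrI [].
Qed.

(* Main.v *)
Require Import Defs.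
From HB Require Import structures.
From mathcomp Require Import all_boot all_order all_algebra.
From mathcomp Require Import ring zify.

(** Write P(q) for the generating function of overpartitions, and multiply it by
    the truncation T_l(q) of the theta series, the sum of (-1)^j q^(j^2) for
    -l < j <= l.  The claim is that, up to sign and constant term, the product
    is a power series whose nonnegativity is visible.  Let G_m be the product
    of (1 + q^j) / (1 - q^j) over j > m and W_m the same product over
    1 <= j <= m, so that P = G_0 = W_m G_m, and let F_m = G_m / (1 - q^m).
    Then, with l = k + 1,
      P T_l = 1 + (-1)^k Q_k,
      Q_k = W_k (q^(l^2) G_l + 2 sum_(m > l) q^(l m) F_m),
    and Q_k has nonnegative coefficients because its factors do.

    Since T_(l+1) - T_l = (-1)^l (q^(l^2) - q^((l+1)^2)), the identity follows
    by induction from Q_k + Q_(k+1) = P (q^((k+1)^2) - q^((k+2)^2)), lemma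
    [remainder_add].  This in turn rests on one telescoping sum,
    [tail_telescope]: because (1 - q^m) F_m = G_m and (1 + q^m) F_m = G_(m-1),
      q^(k m) (1 + q^m) F_m - q^(k (m+1)) (1 - q^m) F_m
        = q^(k m) G_(m-1) - q^(k (m+1)) G_m.

    For strictness, each W_m, G_m, F_m has constant term 1.  If k > 0 then W_k
    contains the factor 1 / (1 - q), so that W_k q^(l^2) alone has every
    coefficient of degree at least l^2 positive.  If k = 0 the sum
    contains q^n F_n, which settles n > 1, and q G_1 settles n = 1
    ([nonneg_remainderB]).

    Only the coefficient of q^n matters, so power series are replaced by
    polynomials modulo q^(N+1).  There q is nilpotent, infinite sums and
    products become finite, and the identities hold exactly in any commutative
    ring with a nilpotent q and inverses of the 1 - q^m.

    Finally [num_overpartitions_coef] identifies the coefficients of P with the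
    numbers of overpartitions, by removing the largest part. *)

Set Implicit Arguments.
Unset Strict Implicit.
Unset Printing Implicit Defensive.

Import Order.TTheory GRing.Theory Num.Theory.
Local Open Scope ring_scope.

(** * The truncated theta identity *)

Section TruncatedTheta.

Variables (A : comNzRingType) (q : A) (inv : nat -> A) (N : nat).

Definition factor (m : nat) : A := (1 + q ^+ m) * inv m.
Definition parts_upto (m : nat) : A := \prod_(1 <= j < m.+1) factor j.
Definition parts_above (m : nat) : A := \prod_(m.+1 <= j < N.+1) factor j.

(** Generates the overpartitions with parts at least [m] in which [m] is not
    overlined. *)
Definition least_part (m : nat) : A := inv m * parts_above m.

(** The summation index is shifted by one: the least parts run over
    [k < m.+1 <= N], so that the telescoping lemma applies as it stands. *)
Definition tail (k : nat) : A :=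
  \sum_(k <= m < N) q ^+ (k * m.+1) * least_part m.+1.

(** The series [Q_k] of the introduction, belonging to the truncation
    [l = k.+1]. *)
Definition remainder (k : nat) : A :=
  parts_upto k
  * (q ^+ (k.+1 ^ 2) * parts_above k.+1 + 2 * tail k.+1).

Hypothesis qN : forall m : nat, (N < m)%N -> q ^+ m = 0.
Hypothesis invK : forall m : nat, (0 < m)%N -> (1 - q ^+ m) * inv m = 1.

Lemma factor_large (m : nat) : (N < m)%N -> factor m = 1.
Proof.
move=> Nm; have := invK (leq_ltn_trans (leq0n N) Nm).
by rewrite /factor qN // subr0 addr0.
Qed.

Lemma parts_uptoS (m : nat) : parts_upto m.+1 = parts_upto m * factor m.+1.
Proof. by rewrite /parts_upto big_nat_recr. Qed.

Lemma parts_aboveS (m : nat) : parts_above m = factor m.+1 * parts_above m.+1.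
Proof.
have [mN|Nm] := ltnP m N; first by rewrite /parts_above big_ltn.
by rewrite factor_large // /parts_above !big_geq ?mulr1 // leqW.
Qed.

Lemma parts_uptoM (m : nat) : parts_upto m * parts_above m = parts_above 0.
Proof.
elim: m => [|m IHm]; first by rewrite /parts_upto big_geq ?mul1r.
by rewrite parts_uptoS -mulrA -parts_aboveS.
Qed.

Lemma subr_least_part (m : nat) : (0 < m)%N ->
  (1 - q ^+ m) * least_part m = parts_above m.
Proof. by move=> m0; rewrite mulrA invK ?mul1r. Qed.

Lemma addr_least_part (m : nat) :
  (1 + q ^+ m.+1) * least_part m.+1 = parts_above m.
Proof. by rewrite mulrA -/(factor _) -parts_aboveS. Qed.

Lemma parts_above_max : parts_above N = 1.
Proof. exact: big_geq. Qed.

(** The two recursions of [least_part] turn each summand into a difference of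
    consecutive values of [q ^+ (k * m.+1) * parts_above m]. *)
Lemma tail_telescope (k : nat) : (k <= N)%N ->
  (1 - q ^+ k) * tail k +
  (1 + q ^+ k) * \sum_(k <= m < N) q ^+ (k.+1 * m.+1) * least_part m.+1
  = q ^+ (k * k.+1) * parts_above k - q ^+ (k * N.+1).
Proof.
move=> kN; pose f m := - (q ^+ (k * m.+1) * parts_above m).
have -> : q ^+ (k * k.+1) * parts_above k - q ^+ (k * N.+1) = f N - f k.
  by rewrite /f parts_above_max mulr1 opprK addrC.
rewrite -telescope_sumr // /tail !mulr_sumr -big_split; apply: eq_bigr => m _ /=.
rewrite /f -(addr_least_part m) -(subr_least_part (ltn0Sn m)) !mulnS mulSn !exprD.
rewrite !exprS; ring.
Qed.

(** The second sum of [tail_telescope] is [tail k.+1] together with its missing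
    first term.  Beyond the truncation order every term vanishes. *)
Lemma tail_recursion (k : nat) : (0 < k)%N ->
  (1 + q ^+ k) * (tail k.+1 + q ^+ (k.+1 ^ 2) * least_part k.+1)
  = q ^+ (k * k.+1) * parts_above k - (1 - q ^+ k) * tail k.
Proof.
move=> k0; have [kN|Nk] := leqP k N; last first.
  have Nk2 : (N < k * k.+1)%N by rewrite (leq_trans Nk) // leq_pmulr.
  rewrite /tail !big_geq ?(ltnW Nk) // 1?leqW 1?ltnW // mulr0 subr0.
  rewrite !qN ?mul0r ?addr0 ?mulr0 //.
  by rewrite (leq_trans Nk) // -mulnn (leq_trans (leqnSn k)) // leq_pmulr.
have := tail_telescope kN; rewrite (qN (m := (k * N.+1)%N)) ?leq_pmull // subr0 => <-.
rewrite addrAC subrr add0r; congr (_ * _).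
have [{}kN|Nk] := ltnP k N; first by rewrite (big_ltn kN) addrC -mulnn.
rewrite /tail !big_geq ?leqW // qN ?mul0r ?addr0 //.
by rewrite -mulnn (leq_trans (_ : N < k.+1)%N) // leq_pmulr.
Qed.

(** The case [k = 0] of the telescoping, where the last term is
    [parts_above N = 1] and does not vanish: it produces the constant term 1 in
    [truncated_theta]. *)
Lemma tail_zero : (0 < N)%N -> parts_above 1 = 1 + 2 * tail 1.
Proof.
move=> N1; pose f m := - parts_above m.
have -> : parts_above 1 = 1 + (f N - f 1%N).
  by rewrite /f parts_above_max opprK addrA subrr add0r.
rewrite -telescope_sumr // /tail mulr_sumr; congr (_ + _); apply: eq_bigr => m _ /=.
rewrite /f -(addr_least_part m) -(subr_least_part (ltn0Sn m)) mul1n; ring.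
Qed.

Lemma remainder0 : (0 < N)%N ->
  remainder 0 + 1 = parts_above 0 * (1 - q).
Proof.
move=> N1; rewrite -(addr_least_part 0) expr1.
have := tail_zero N1; have := subr_least_part (ltn0Sn 0); rewrite expr1.
rewrite /remainder /parts_upto big_geq // mul1r => <- E.
rewrite -addrA [2 * _ + 1]addrC -E expr1; ring.
Qed.

(** By [tail_recursion], the contribution of [tail k.+2] to [remainder k.+1]
    cancels that of [tail k.+1] to [remainder k]; what is left recombines into
    multiples of the full product. *)
Lemma remainder_add (k : nat) :
  remainder k + remainder k.+1
  = parts_above 0 * (q ^+ (k.+1 ^ 2) - q ^+ (k.+2 ^ 2)).
Proof.
set a := q ^+ _; set b := q ^+ _.
have E : 2 * tail k.+2 + b * parts_above k.+2
    = 2 * (tail k.+2 + b * least_part k.+2) - b * parts_above k.+1.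
  by rewrite -(subr_least_part (ltn0Sn k.+1)) -(addr_least_part k.+1); ring.
rewrite -(parts_uptoM k.+1) /remainder -/a -/b parts_uptoS /factor.
rewrite [b * _ + _]addrC E; set x := q ^+ k.+1.
have rec : (1 + x) * (tail k.+2 + b * least_part k.+2)
    = a * x * parts_above k.+1 - (1 - x) * tail k.+1.
  by rewrite tail_recursion // mulnS addnC exprD mulnn.
(* Exposes the left-hand side of [rec]. *)
have -> : forall W i G t, W * ((1 + x) * i) * (2 * t - b * G)
    = W * i * (2 * ((1 + x) * t) - (1 + x) * b * G) :> A by move=> *; ring.
(* Both sides become multiples of [inv k.+1] once [remainder k] is multiplied
   by [1 = (1 - x) * inv k.+1]. *)
rewrite rec -[X in X + _ = _]mulr1 -[X in _ * X + _ = _](invK (ltn0Sn k)) -/x; ring.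
Qed.

(** The sum over [j] is the truncated theta series, with the terms of index
    [- j] and [j.+1] grouped together. *)
Lemma truncated_theta (k : nat) : (0 < N)%N ->
  parts_above 0 *
    \sum_(j < k.+1) (-1) ^+ j * (q ^+ (j ^ 2) - q ^+ (j.+1 ^ 2))
  = 1 + (-1) ^+ k * remainder k.
Proof.
move=> N1; elim: k => [|k IHk].
  by rewrite big_ord1 mul1r expr0 !mul1r [RHS]addrC remainder0 // exp0n.
rewrite big_ord_recr mulrDr IHk /= [parts_above 0 * _]mulrCA.
by rewrite -remainder_add mulrDr !addrA exprS !mulN1r !mulNr addrK.
Qed.

End TruncatedTheta.

(** * Power series modulo [q ^+ N.+1] *)

Section Truncated.

Variable N : nat.
Local Notation T := {poly %/ ('X^(N.+1) : {poly int})}.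

Definition coef (x : T) (n : nat) : int := (val x)`_n.

Lemma coef_add (x y : T) (n : nat) : coef (x + y) n = coef x n + coef y n.
Proof. exact: coefD. Qed.

Lemma coef_sub (x y : T) (n : nat) : coef (x - y) n = coef x n - coef y n.
Proof. exact: coefB. Qed.

Lemma coef_in (p : {poly int}) (n : nat) :
  coef (in_qpoly _ p) n = if (n <= N)%N then p`_n else 0.
Proof.
by rewrite /coef /= mk_monic_Xn -Pdiv.RingMonic.take_poly_rmodp coef_take_poly.
Qed.

Definition qvar : T := in_qpoly _ 'X.
Definition geom (m : nat) : T := \sum_(j < N.+1) qvar ^+ m ^+ j.

Lemma qvarX (m : nat) : qvar ^+ m = in_qpoly _ 'X^m.
Proof. by rewrite rmorphXn. Qed.

Lemma in_qpoly_val (x : T) : in_qpoly _ (val x) = x.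
Proof. by apply/val_inj/in_qpoly_small/size_mk_monic. Qed.

Lemma eq_coef (x y : T) : (forall n, (n <= N)%N -> coef x n = coef y n) -> x = y.
Proof.
move=> xy; rewrite -[x]in_qpoly_val -[y]in_qpoly_val; apply/val_inj/polyP=> n.
have := coef_in (val x) n; have := coef_in (val y) n; rewrite /coef => -> ->.
by case: ifP => // /xy.
Qed.

Lemma coef_qvarM (m n : nat) (x : T) : (n <= N)%N ->
  coef (qvar ^+ m * x) n = if (n < m)%N then 0 else coef x (n - m).
Proof.
by move=> nN; rewrite -[x in LHS]in_qpoly_val qvarX -rmorphM coef_in nN coefXnM.
Qed.

Lemma qvar_nilp (m : nat) : (N < m)%N -> qvar ^+ m = 0.
Proof.
move=> Nm; apply: eq_coef => n nN; rewrite -[_ ^+ _]mulr1 coef_qvarM //.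
by rewrite (leq_ltn_trans nN Nm) /coef coef0.
Qed.

Lemma geomK (m : nat) : (0 < m)%N -> (1 - qvar ^+ m) * geom m = 1.
Proof.
move=> m0; rewrite -opprB mulNr -subrX1 -exprM qvar_nilp ?sub0r ?opprK //.
by rewrite leq_pmull.
Qed.

(** Stated through [polyOver] so that closure under sums and products is
    inherited from polynomials. *)
Definition nonneg_pred (x : T) :=
  (val x : {poly int}) \is a polyOver (@Num.Def.nneg_num_pred int).
Definition nonneg := [qualify a x | nonneg_pred x].

Fact nonneg_addr_closed : addr_closed nonneg.
Proof.
by split=> [|x y x0 y0]; rewrite qualifE /nonneg_pred; [apply: rpred0 | apply: rpredD].
Qed.

Lemma nonneg_in (p : {poly int}) :
  p \is a polyOver (@Num.Def.nneg_num_pred int) -> in_qpoly _ p \is a nonneg.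
Proof.
move=> p0; apply/polyOverP => n; have := coef_in p n; rewrite /coef /= => ->.
by case: ifP => // _; apply: (polyOverP p0).
Qed.

Fact nonneg_mulr_closed : mulr_closed nonneg.
Proof.
split=> [|x y x0 y0]; first by rewrite -(rmorph1 (in_qpoly _)) nonneg_in // rpred1.
by rewrite -[x]in_qpoly_val -[y]in_qpoly_val -rmorphM nonneg_in // rpredM.
Qed.

HB.instance Definition _ := GRing.isAddClosed.Build T nonneg_pred nonneg_addr_closed.
HB.instance Definition _ := GRing.isMulClosed.Build T nonneg_pred nonneg_mulr_closed.

Lemma nonneg_coef (x : T) (n : nat) : x \is a nonneg -> 0 <= coef x n.
Proof. by move/polyOverP/(_ n). Qed.

Lemma nonneg_qvar : qvar \is a nonneg.
Proof. by rewrite nonneg_in // polyOverX. Qed.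

Lemma nonneg_geom (m : nat) : geom m \is a nonneg.
Proof. by rewrite rpred_sum // => j _; rewrite !rpredX // nonneg_qvar. Qed.

Lemma nonneg_geomB (m j : nat) : (0 < m)%N -> geom m - qvar ^+ (m * j) \is a nonneg.
Proof.
move=> m0; have [jN|Nj] := leqP j N; last first.
  by rewrite qvar_nilp ?subr0 ?nonneg_geom // (leq_trans Nj) // leq_pmull.
rewrite /geom (bigD1 (Ordinal (jN : (j < N.+1)%N))) //= -exprM addrAC subrr add0r.
by rewrite rpred_sum // => i _; rewrite !rpredX // nonneg_qvar.
Qed.

(** Multiplication is monotone for the coefficientwise order, in which [x]
    dominates [u] when [x - u] is nonnegative. *)
Lemma nonneg_mulB (x y u v : T) : u \is a nonneg -> v \is a nonneg ->
  x - u \is a nonneg -> y - v \is a nonneg -> x * y - u * v \is a nonneg.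
Proof.
move=> u0 v0 xu yv.
have -> : x * y - u * v = (x - u) * (y - v) + (u * (y - v) + (x - u) * v) by ring.
by rewrite !rpredD // rpredM.
Qed.

Lemma nonneg_prodB1 (r : seq nat) (f : nat -> T) :
  (forall i, f i - 1 \is a nonneg) -> \prod_(i <- r) f i - 1 \is a nonneg.
Proof.
move=> f1; apply: (big_ind (fun x : T => x - 1 \is a nonneg)) => // [|x y x1 y1].
  by rewrite subrr rpred0.
by rewrite -[X in _ - X]mulr1 nonneg_mulB // rpred1.
Qed.

(** * Positivity of the remainder *)

Local Notation upto := (parts_upto qvar geom).
Local Notation above := (parts_above qvar geom N).
Local Notation tails := (tail qvar geom N).
Local Notation rem := (remainder qvar geom N).

Lemma nonneg_geomB1 (m : nat) : (0 < m)%N -> geom m - 1 \is a nonneg.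
Proof. by move=> m0; have := nonneg_geomB 0 m0; rewrite muln0 expr0. Qed.

Lemma nonneg_factor (m : nat) : factor qvar geom m \is a nonneg.
Proof. by rewrite rpredM ?nonneg_geom // rpredD ?rpred1 // rpredX ?nonneg_qvar. Qed.

Lemma nonneg_factorB1 (m : nat) : (0 < m)%N -> factor qvar geom m - 1 \is a nonneg.
Proof.
move=> m0; rewrite -[X in _ - X]mulr1 nonneg_mulB ?rpred1 ?nonneg_geomB1 //.
by rewrite addrAC subrr add0r rpredX ?nonneg_qvar.
Qed.

Lemma nonneg_prod_factorB1 (m n : nat) : (0 < m)%N ->
  \prod_(m <= j < n) factor qvar geom j - 1 \is a nonneg.
Proof.
move=> m0; rewrite big_nat_cond big_mkcond nonneg_prodB1 // => j.
case: ifP => [/andP[/andP[mj _] _]|_]; last by rewrite subrr rpred0.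
by rewrite nonneg_factorB1 // (leq_trans m0).
Qed.

Lemma nonneg_upto (m : nat) : upto m \is a nonneg.
Proof. by rewrite rpred_prod // => j _; apply: nonneg_factor. Qed.

Lemma nonneg_above (m : nat) : above m \is a nonneg.
Proof. by rewrite rpred_prod // => j _; apply: nonneg_factor. Qed.

Lemma nonneg_tail (k : nat) : tails k \is a nonneg.
Proof.
rewrite rpred_sum // => m _.
by rewrite rpredM ?rpredX ?nonneg_qvar // rpredM ?nonneg_geom ?nonneg_above.
Qed.

Lemma nonneg_remainder (k : nat) : rem k \is a nonneg.
Proof.
rewrite rpredM ?nonneg_upto // rpredD //.
  by rewrite rpredM ?nonneg_above // rpredX ?nonneg_qvar.
by rewrite rpredM ?nonneg_tail // rpred_nat.
Qed.

(** For [n = 1] the monomial comes from [q * parts_above 1], for [n > 1] from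
    the summand of [tail 1] with least part [n]. *)
Lemma nonneg_remainderB0 (n : nat) : (0 < n <= N)%N ->
  rem 0 - qvar ^+ n \is a nonneg.
Proof.
case/andP=> n0 nN; rewrite /remainder /parts_upto big_geq // mul1r expr1.
case: n n0 nN => // -[_ _|n _ nN].
  rewrite addrAC rpredD //.
    rewrite -[X in _ - X]mulr1 nonneg_mulB ?rpred1 ?rpredX ?nonneg_qvar //.
      by rewrite subrr rpred0.
    exact: nonneg_prod_factorB1.
  by rewrite rpredM ?nonneg_tail // rpred_nat.
rewrite -addrA rpredD //.
  by rewrite rpredM ?nonneg_above // ?rpredX ?nonneg_qvar.
rewrite mulr_natl mulr2n -addrA rpredD ?nonneg_tail //.
rewrite /tail (bigD1_seq n.+1) ?mem_index_iota ?iota_uniq //= addrAC rpredD //; last first.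
  rewrite rpred_sum // => m _.
  by rewrite rpredM ?rpredX ?nonneg_qvar // rpredM ?nonneg_geom ?nonneg_above.
rewrite mul1n -[X in _ - X]mulr1 nonneg_mulB ?rpred1 ?rpredX ?nonneg_qvar //.
  by rewrite subrr rpred0.
by rewrite -[X in _ - X]mulr1 nonneg_mulB ?rpred1 ?nonneg_geomB1 ?nonneg_prod_factorB1.
Qed.

(** The factor [geom 1] has all its coefficients equal to 1. *)
Lemma nonneg_uptoB (k j : nat) : upto k.+1 - qvar ^+ j \is a nonneg.
Proof.
rewrite /parts_upto big_ltn // -[X in _ - X]mulr1.
apply: nonneg_mulB; rewrite ?rpred1 ?nonneg_prod_factorB1 ?rpredX ?nonneg_qvar //.
rewrite -[X in _ - X]mul1r nonneg_mulB ?rpred1 ?rpredX ?nonneg_qvar //.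
  by rewrite addrAC subrr add0r rpredX ?nonneg_qvar.
by have := nonneg_geomB j (ltn0Sn 0); rewrite mul1n.
Qed.

Lemma nonneg_remainderB (k n : nat) : (k.+1 ^ 2 <= n <= N)%N ->
  rem k - qvar ^+ n \is a nonneg.
Proof.
case: k => [|k]; first exact: nonneg_remainderB0.
case/andP=> kn nN; rewrite -(subnK kn) exprD.
rewrite nonneg_mulB ?nonneg_uptoB ?rpredX ?nonneg_qvar //.
rewrite addrAC rpredD //; last by rewrite rpredM ?nonneg_tail // rpred_nat.
rewrite -[X in _ - X]mulr1 nonneg_mulB ?rpred1 ?rpredX ?nonneg_qvar //.
  by rewrite subrr rpred0.
exact: nonneg_prod_factorB1.
Qed.

End Truncated.

(** * Counting overpartitions *)

Definition weight (s : seq (nat * bool)) : nat := sumn [seq x.1 | x <- s].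
Definition positive (s : seq (nat * bool)) : bool := all (fun x => 0 < x.1)%N s.

(** Counting by an explicit duplicate-free enumeration, the form required by
    [num_overpartitionsE]; the count is an integer so that it can be compared
    with coefficients. *)
Definition counted (P : pred (seq (nat * bool))) (n : nat) (c : int) : Prop :=
  exists e, [/\ uniq e, forall s, (s \in e) = [&& P s, positive s & weight s == n]
    & (size e)%:Z = c].

Definition bounded (m : nat) : pred (seq (nat * bool)) :=
  fun s => sorted may_follow s && all (fun x => x.1 <= m)%N s.

(** What may come after a part [m]: the parts are at most [m], and [m] is not
    overlined again.  Whether that first part is overlined is immaterial, see
    [path_may_follow]; [true] is an arbitrary choice. *)
Definition after (m : nat) : pred (seq (nat * bool)) := path may_follow (m, true).

Lemma may_follow_trans : transitive may_follow.
Proof. by move=> [y c] [x b] [z d]; rewrite /may_follow /=; lia. Qed.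

Lemma path_may_follow (m : nat) (b : bool) (s : seq (nat * bool)) :
  path may_follow (m, b) s = after m s.
Proof. by case: s. Qed.

Lemma after_cons (m j : nat) (b : bool) (s : seq (nat * bool)) :
  after m ((j, b) :: s) = ((j < m) || (j == m) && ~~ b)%N && after j s.
Proof. by rewrite /after /= path_may_follow. Qed.

Lemma bounded_cons (m j : nat) (b : bool) (s : seq (nat * bool)) :
  bounded m ((j, b) :: s) = (j <= m)%N && after j s.
Proof.
rewrite /bounded /= path_may_follow andbCA andbA; apply/andb_idr => /andP[jm js].
have := order_path_min may_follow_trans js; apply: sub_all => -[i c] /=.
by rewrite /may_follow /=; lia.
Qed.

Lemma counted_bounded0 (n : nat) : counted (bounded 0) n (n == 0%N)%:R.
Proof.
exists (if n == 0%N then [:: [::]] else [::]); split; try by case: ifP.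
case=> [|[j b] s]; first by rewrite /= [weight _ == n]eq_sym; case: ifP.
by rewrite bounded_cons /=; case: j; case: ifP; rewrite // andbF.
Qed.

(** A list that may come after [m.+1] has parts at most [m], or starts with a
    plain [m.+1].  On generating functions this is [a = w + q ^+ m.+1 * a]. *)
Lemma counted_after (m n : nat) (w a : nat -> int) :
  (forall i, (i <= n)%N -> counted (bounded m) i (w i)) ->
  (forall i, (i <= n)%N -> a i = w i + if (i < m.+1)%N then 0 else a (i - m.+1)%N) ->
  forall i, (i <= n)%N -> counted (after m.+1) i (a i).
Proof.
move=> Hw Ha; elim/ltn_ind=> i IH i_n; rewrite Ha //.
have [e [ue eP <-]] := Hw i i_n.
case: ltnP => im.
  exists e; split; rewrite ?addr0 // => s; rewrite eP.
  case: s => // -[j b] s; rewrite bounded_cons after_cons /weight /=.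
  case: (after j s); lia.
have im' : (i - m.+1 < i)%N by lia.
have [e' [ue' eP' <-]] := IH _ im' (leq_trans (ltnW im') i_n).
exists (e ++ [seq (m.+1, false) :: s | s <- e']); split; last first.
- by rewrite size_cat size_map PoszD.
- case=> [|[j b] s]; rewrite mem_cat eP.
    by rewrite [[::] \in map _ _](_ : _ = false) ?orbF //; apply/mapP => -[].
  have -> : ((j, b) :: s \in [seq (m.+1, false) :: s0 | s0 <- e'])
      = [&& j == m.+1, ~~ b & s \in e'].
    apply/mapP/and3P => [[s0 s0e [-> -> ->]] //|[/eqP -> /negPf -> se]].
    by exists s.
  rewrite eP' bounded_cons after_cons /weight /=.
  by have [->|] := eqVneq j m.+1; case: (after j s); case: b; case: (positive s); lia.
rewrite cat_uniq ue map_inj_uniq ?ue' ?andbT => [|s t [] //].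
apply/hasPn => _ /mapP[s _ ->]; rewrite eP bounded_cons; lia.
Qed.

(** A largest part equal to [m.+1] can be overlined or not, whence the 2. *)
Lemma counted_bounded_step (m n : nat) (w c : int) :
  counted (bounded m) n w ->
  ((m < n)%N -> counted (after m.+1) (n - m.+1) c) ->
  counted (bounded m.+1) n (w + 2 * if (n < m.+1)%N then 0 else c).
Proof.
case=> e [ue eP <-] Hc; case: ltnP => [nm|mn].
  exists e; split; rewrite ?mulr0 ?addr0 // => s; rewrite eP.
  case: s => // -[j b] s; rewrite !bounded_cons /weight /=.
  case: (after j s); lia.
have [e' [ue' eP' <-]] := Hc mn.
pose add b := [seq (m.+1, b) :: s | s <- e'].
have addP b0 j b s : ((j, b) :: s \in add b0) = [&& j == m.+1, b == b0 & s \in e'].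
  apply/mapP/and3P => [[t te [-> -> ->]] //|[/eqP -> /eqP -> se]].
  by exists s.
have addN b : ([::] \in add b) = false by apply/mapP => -[].
have addu b : uniq (add b) by rewrite map_inj_uniq // => s t [].
exists (e ++ add true ++ add false); split; last 2 first.
- case=> [|[j b] s]; rewrite !mem_cat eP.
    by rewrite !addN !orbF.
  rewrite !addP eP' !bounded_cons /weight /=.
  by have [->|] := eqVneq j m.+1; case: (after j s); case: b; case: (positive s); lia.
- by rewrite !size_cat !size_map !PoszD mulr_natl mulr2n.
rewrite !cat_uniq ue !addu !andbT /=; apply/andP; split; apply/hasPn => s.
  rewrite mem_cat; case: s => [|[j b] s].
    by rewrite !addN.
  by rewrite !addP eP bounded_cons; lia.
case: s => [|[j b] s]; last by rewrite !addP; lia.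
by case/mapP.
Qed.

(** The series of [bounded m] is [w m], that of [after m.+1] is
    [a = w m / (1 - q ^+ m.+1)], and [w m.+1 = w m + 2 * q ^+ m.+1 * a]. *)
Lemma num_overpartitions_coef (N n : nat) : (n <= N)%N ->
  (num_overpartitions n)%:Z = coef (parts_above (qvar N) (geom N) N 0) n.
Proof.
move=> nN; rewrite /parts_above -/(parts_upto _ _ N).
set w := parts_upto (qvar N) (geom N).
have Hw m i : (i <= N)%N -> counted (bounded m) i (coef (w m) i).
  elim: m i => [|m IHm] i iN.
    have -> : coef (w 0%N) i = (i == 0%N)%:R.
      by rewrite /w /parts_upto big_geq // /coef coef1; case: eqP.
    exact: counted_bounded0.
  pose a := w m * geom N m.+1.
  have aE : a = w m + qvar N ^+ m.+1 * a.
    have {1}<- : (1 - qvar N ^+ m.+1) * a = w m by rewrite mulrCA geomK ?mulr1.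
    ring.
  have -> : coef (w m.+1) i
      = coef (w m) i + 2 * if (i < m.+1)%N then 0 else coef a (i - m.+1)%N.
    have -> : w m.+1 = w m + (qvar N ^+ m.+1 * a + qvar N ^+ m.+1 * a).
      by rewrite addrA -aE /a /w parts_uptoS /factor; ring.
    by rewrite mulr_natl mulr2n -coef_qvarM // !coef_add.
  apply: counted_bounded_step => [|mi]; first exact: IHm.
  apply: (counted_after (n := N) (w := coef (w m))) => [//|j jN|]; last by lia.
  by rewrite {1}aE -coef_qvarM // coef_add.
have [e [ue eP <-]] := Hw N n nN.
rewrite (num_overpartitionsE ue) // => s; rewrite eP /is_overpartition.
apply/and3P/and3P => [[/andP[]] //|[ss sp sn]]; split=> //.
have /overpartition_bounds[_] : is_overpartition n s by apply/and3P.
by rewrite /bounded ss; apply: sub_all => x xn; apply: leq_trans xn nN.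
Qed.

(** * The alternating sum *)

Lemma sum_int_range (l : nat) (f : int -> int) :
  \sum_(j <- int_range (- l%:Z + 1) l%:Z) f j
  = \sum_(j < l) (f (- j%:Z) + f (j.+1%:Z)).
Proof.
rewrite big_split /= -(big_mkord xpredT (fun j => f (- j%:Z))).
rewrite -(big_mkord xpredT (fun j : nat => f j.+1%:Z)) /=.
rewrite -(big_map (fun j : nat => - j%:Z) xpredT f).
rewrite -(big_map (fun j : nat => j.+1%:Z) xpredT f) -big_cat /=.
apply/perm_big/uniq_perm; first exact: int_range_uniq.
  rewrite cat_uniq !map_inj_uniq ?iota_uniq ?andbT /=.
  - by apply/hasPn => _ /mapP[i _ ->]; apply/mapP => -[j _]; lia.
  - by move=> i j; lia.
  - by move=> i j; lia.
move=> j; rewrite mem_int_range mem_cat; apply/idP/orP => [jl|].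
  case: (lerP j 0) => j0; [left|right]; apply/mapP.
    by exists `|j|%N; [rewrite mem_index_iota|]; lia.
  by exists `|j|.-1%N; [rewrite mem_index_iota|]; lia.
by case=> /mapP[i]; rewrite mem_index_iota; lia.
Qed.

Lemma pbar_coef (n a : nat) :
  pbar (n%:Z - a%:Z)
  = coef (parts_above (qvar n) (geom n) n 0 * qvar n ^+ a) n.
Proof.
rewrite mulrC coef_qvarM //; case: ltnP => na.
  have [m ->] : exists m : nat, n%:Z - a%:Z = Negz m by exists (a - n).-1; lia.
  by [].
have -> : n%:Z - a%:Z = Posz (n - a) by lia.
by rewrite -num_overpartitions_coef // leq_subr.
Qed.

(** The constant term 1 of [truncated_theta] does not reach the coefficient of
    degree [n > 0]. *)
Lemma truncated_sum (n k : nat) : (0 < n)%N ->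
  \sum_(j <- int_range (- k.+1%:Z + 1) k.+1%:Z) (-1) ^ j * pbar (n%:Z - j ^+ 2)
  = (-1) ^+ k * coef (remainder (qvar n) (geom n) n k) n.
Proof.
move=> n0; rewrite sum_int_range.
have coef_sign i x : coef ((-1) ^+ i * x) n = (-1) ^+ i * coef x n.
  by rewrite -signr_odd -[in RHS]signr_odd; case: odd;
    rewrite !(expr0, expr1) ?mul1r // !mulN1r /coef coefN.
have coef_const : coef (1 : {poly %/ ('X^(n.+1) : {poly int})}) n = 0.
  by rewrite /coef coef1; case: n n0 {coef_sign}.
have E := truncated_theta (qvar_nilp (N := n)) (geomK n) k n0.
have -> : (-1) ^+ k * coef (remainder (qvar n) (geom n) n k) n
    = coef (1 + (-1) ^+ k * remainder (qvar n) (geom n) n k) n.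
  by rewrite coef_add coef_const add0r coef_sign.
rewrite -E mulr_sumr [RHS]coefn_sum; apply: eq_bigr => j _.
rewrite mulrCA -[RHS]/(coef _ n) coef_sign mulrBr coef_sub -!pbar_coef.
have sqr (i : nat) : i%:Z ^+ 2 = (i ^ 2)%N by rewrite -mulnn PoszM.
by rewrite mulrBr sqrrN !sqr -exprz_inv invrN1 -exprnP -exprnP exprS mulN1r mulNr.
Qed.

Theorem corollary4p4 (n l : nat) (n_ge1 : (1 <= n)%N) (l_ge1 : (1 <= l)%N) :
  let S : int := (-1) ^ (l%:Z - 1) *
    \sum_(j <- int_range (- l%:Z + 1) l%:Z) (-1) ^ j * pbar (n%:Z - j ^+ 2) in
  0 <= S /\ ((l ^ 2 <= n)%N -> 0 < S).
Proof.
case: l l_ge1 => // k _ S.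
have -> : S = coef (remainder (qvar n) (geom n) n k) n.
  rewrite /S truncated_sum // (_ : k.+1%:Z - 1 = k) ?mulrA; last by lia.
  by rewrite -exprMn mulrNN mulr1 expr1n mul1r.
split=> [|kn]; first exact/nonneg_coef/nonneg_remainder.
have := nonneg_coef n (nonneg_remainderB (N := n) (k := k) (n := n) _).
rewrite kn leqnn => /(_ isT); rewrite coef_sub subr_ge0; apply: lt_le_trans.
by rewrite -[qvar n ^+ n]mulr1 coef_qvarM // ltnn subnn /coef coef1.
Qed.
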